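(* Let $(R,\mathfrak m)$ be a Noetherian local ring with infinite residue field. Let $\{I_n\}_{n\ge1}$ be a filtration of proper ideals of $R$ (i.e. $I_{n+1}\subseteq I_n$ and $I_aI_b\subseteq I_{a+b}$ for all $a,b\ge1$) such that $\dim R/I_n=\dim R/I_1$ for all $n\ge1$. Then: (i) $r(R/I_n)\le [r(R/I_1)+1]n-1$ for all $n\ge1$; (ii) the limit $c=\lim_{n\to\infty} r(R/I_n)/n$ exists and $r(R/I_n)\ge cn-1$ for all $n\ge1$.
   Context: For a Noetherian local ring $(A,\mathfrak n)$ with infinite residue field: an $\mathfrak n$-primary ideal $\mathfrak q\subseteq\mathfrak n$ is a reduction of $\mathfrak n$ if $\mathfrak n^{r+1}=\mathfrak q\mathfrak n^r$ for some $r\ge0$; the least such $r$ is the reduction number $r_{\mathfrak q}(A)$. A reduction is minimal if it contains no other reduction of $\mathfrak n$. Set $r(A)=\min\{r_{\mathfrak q}(A):\ \mathfrak q \text{ a minimal reduction of }\mathfrak n\}$. *)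

(* Defs.v *)
From HB Require Import structures.
From mathcomp Require Import all_boot all_algebra.
From mathcomp Require Import boolp generic_quotient ring_quotient.


Set Implicit Arguments.
Unset Strict Implicit.
Unset Printing Implicit Defensive.

Import GRing.Theory.
Local Open Scope ring_scope.
Local Open Scope quotient_scope.

Section Ideals.
Variable A : comNzRingType.

Definition is_ideal (S : A -> Prop) : Prop :=
  [/\ S 0, (forall x y, S x -> S y -> S (x + y)) & (forall a x, S x -> S (a * x))].

Definition subI (S T : A -> Prop) : Prop := forall x, S x -> T x.
Definition eqI (S T : A -> Prop) : Prop := forall x, S x <-> T x.

Definition prodI (S T : A -> Prop) : A -> Prop := fun x =>
  exists k (a b : 'I_k -> A), (forall i, S (a i) /\ T (b i)) /\
                              x = \sum_(i < k) a i * b i.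

Definition fullI : A -> Prop := fun _ => True.

Fixpoint powI (S : A -> Prop) (k : nat) : A -> Prop :=
  if k is k'.+1 then prodI (powI S k') S else fullI.

Definition radicalI (S : A -> Prop) : A -> Prop := fun x => exists k, S (x ^+ k).

Definition is_prime_ideal (P : A -> Prop) : Prop :=
  [/\ is_ideal P, ~ P 1 & forall x y, P (x * y) -> P x \/ P y].

Definition is_primary_ideal (Q : A -> Prop) : Prop :=
  [/\ is_ideal Q, ~ Q 1 & forall x y, Q (x * y) -> ~ Q x -> radicalI Q y].

Definition is_max_ideal (M : A -> Prop) : Prop :=
  [/\ is_ideal M, ~ M 1 &
      forall J, is_ideal J -> subI M J -> ~ J 1 -> subI J M].

Definition local_ring_with (m : A -> Prop) : Prop :=
  is_max_ideal m /\ forall M, is_max_ideal M -> eqI M m.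

Definition noetherian : Prop :=
  forall S, is_ideal S -> exists k (g : 'I_k -> A),
    forall x, S x <-> exists c : 'I_k -> A, x = \sum_(i < k) c i * g i.

Definition infinite_residue_field (m : A -> Prop) : Prop :=
  forall s : seq A, exists x, forall y, y \in s -> ~ m (x - y).

Definition has_prime_chain (k : nat) : Prop :=
  exists P : nat -> (A -> Prop),
    (forall i, (i <= k)%N -> is_prime_ideal (P i)) /\
    (forall i, (i < k)%N -> subI (P i) (P i.+1) /\ ~ subI (P i.+1) (P i)).

Definition is_krull_dim (d : nat) : Prop :=
  has_prime_chain d /\ forall k, has_prime_chain k -> (k <= d)%N.

(* Krull dimension: Some d if it is finite and equal to d, None if infinite
   (or if A has no prime ideal, which does not happen for nonzero rings) *)
Definition krull_dim : option nat :=
  match pselect (exists d, is_krull_dim d) with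
  | left H => Some (projT1 (cid H))
  | right _ => None
  end.

(* Reductions relative to the maximal ideal n of the local ring (A, n) *)
Variable n : A -> Prop.

Definition n_primary (q : A -> Prop) : Prop :=
  is_primary_ideal q /\ eqI (radicalI q) n.

Definition reduction_eq (q : A -> Prop) (r : nat) : Prop :=
  eqI (powI n r.+1) (prodI q (powI n r)).

Definition is_reduction (q : A -> Prop) : Prop :=
  [/\ n_primary q, subI q n & exists r, reduction_eq q r].

Definition is_minimal_reduction (q : A -> Prop) : Prop :=
  is_reduction q /\
  forall q', is_reduction q' -> subI q' q -> eqI q' q.

Definition is_reduction_number (q : A -> Prop) (r : nat) : Prop :=
  reduction_eq q r /\ forall s, reduction_eq q s -> (r <= s)%N.

Definition is_r (r : nat) : Prop :=
  (exists q, is_minimal_reduction q /\ is_reduction_number q r) /\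
  forall q s, is_minimal_reduction q -> is_reduction_number q s -> (r <= s)%N.

(* r(A); the default value 0 is never used for a Noetherian local ring *)
Definition r_num : nat :=
  match pselect (exists r, is_r r) with
  | left H => projT1 (cid H)
  | right _ => 0%N
  end.

End Ideals.

Definition quot_ideal (R : comNzRingType) (I : idealr R) (m : R -> Prop)
  : {ideal_quot I} -> Prop :=
  fun x => exists y, m y /\ (\pi_({ideal_quot I}) y) = x.

Definition r_quot (R : comNzRingType) (m : R -> Prop) (I : idealr R) : nat :=
  r_num (@quot_ideal R I m).

Definition dim_quot (R : comNzRingType) (I : idealr R) : option nat :=
  krull_dim {ideal_quot I}.

(* Main.v *)
Require Import Defs.
From HB Require Import structures.
From mathcomp Require Import all_boot all_algebra ring_quotient.
From mathcomp Require Import boolp classical_sets generic_quotient zify ring.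
From Stdlib Require Reals.

(* Because I_1^n is contained in I_n, an ideal is a reduction of m modulo I_a
   iff it is one modulo I_b, for any a, b >= 1; more precisely, from
   m^(r+1) <= Q m^r + I_a and m^(s+1) <= Q m^s + I_b one gets
   m^(r+s+2) <= Q m^(r+s+1) + I_(a+b). So a minimal reduction modulo I_(ak)
   can be found inside one modulo I_a, and a minimal reduction modulo I_b pushes
   forward to one modulo I_a when a <= b. Hence u_n = r(R/I_n) + 1 is
   nondecreasing with u_(ak) <= k u_a, which gives (i) as well as
   lim u_n / n = inf u_n / n, that is (ii). *)

Set Implicit Arguments.
Unset Strict Implicit.
Unset Printing Implicit Defensive.

Import GRing.Theory.

(** * Sums, products, powers and finite generation of ideals given as predicates *)

Section IdealArithmetic.
Local Open Scope ring_scope.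
Variable A : comNzRingType.
Implicit Types S T U K N Q : A -> Prop.

Definition addI S T : A -> Prop := fun x => exists s t, [/\ S s, T t & x = s + t].

Lemma eqI_eq S T : eqI S T -> S = T.
Proof. by move=> eST; apply/funext => x; apply/propext. Qed.

Lemma eq_subI S T : subI S T -> subI T S -> S = T.
Proof. by move=> ST TS; apply: eqI_eq => x; split; [apply: ST | apply: TS]. Qed.

Lemma idealN S x : is_ideal S -> S x -> S (- x).
Proof. by case=> _ _ SM Sx; rewrite -mulN1r; apply: SM. Qed.

Lemma idealB S x y : is_ideal S -> S x -> S y -> S (x - y).
Proof. by move=> iS Sx Sy; case: (iS) => _ SD _; apply: SD => //; apply: idealN. Qed.

Lemma ideal_addI S T : is_ideal S -> is_ideal T -> is_ideal (addI S T).
Proof.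
case=> S0 SD SM [T0 TD TM]; split.
- by exists 0, 0; rewrite addr0.
- move=> _ _ [s [t [Ss Tt ->]]] [s' [t' [Ss' Tt' ->]]].
  by exists (s + s'), (t + t'); split; [apply: SD | apply: TD | rewrite addrACA].
- move=> a _ [s [t [Ss Tt ->]]]; exists (a * s), (a * t).
  by split; [apply: SM | apply: TM | rewrite mulrDr].
Qed.

Lemma addI_subl S T : is_ideal T -> subI S (addI S T).
Proof. by case=> T0 _ _ x Sx; exists x, 0; rewrite addr0. Qed.

Lemma addI_subr S T : is_ideal S -> subI T (addI S T).
Proof. by case=> S0 _ _ x Tx; exists 0, x; rewrite add0r. Qed.

Lemma addI_sub S T U : is_ideal U -> subI S U -> subI T U -> subI (addI S T) U.
Proof. by case=> _ UD _ SU TU _ [s [t [/SU Us /TU Ut ->]]]; apply: UD. Qed.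

Lemma ideal_prodI S T : is_ideal S -> is_ideal (prodI S T).
Proof.
case=> S0 SD SM; split.
- by exists 0, (fun=> 0), (fun=> 0); split; [case | rewrite big_ord0].
- move=> _ _ [k [a [b [abP ->]]]] [k' [a' [b' [abP' ->]]]].
  exists (k + k')%N, (fun i => match split i with inl j => a j | inr j => a' j end),
    (fun i => match split i with inl j => b j | inr j => b' j end); split.
    by move=> i; case: (split i).
  rewrite big_split_ord; congr (_ + _); apply: eq_bigr => i _.
    by rewrite (unsplitK (inl i)).
  by rewrite (unsplitK (inr i)).
- move=> c _ [k [a [b [abP ->]]]]; exists k, (fun i => c * a i), b.
  split=> [i|]; first by case: (abP i) => ? ?; split=> //; apply: SM.
  by rewrite mulr_sumr; apply: eq_bigr => i _; rewrite mulrA.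
Qed.

Lemma mem_prodI S T x y : S x -> T y -> prodI S T (x * y).
Proof.
by move=> Sx Ty; exists 1%N, (fun=> x), (fun=> y); rewrite big_ord1.
Qed.

Lemma prodI_sub S T U :
  is_ideal U -> (forall x y, S x -> T y -> U (x * y)) -> subI (prodI S T) U.
Proof.
case=> U0 UD _ STU _ [k [a [b [abP ->]]]].
by elim/big_ind: _ => // i _; case: (abP i); apply: STU.
Qed.

Lemma prodIS S S' T T' : subI S S' -> subI T T' -> subI (prodI S T) (prodI S' T').
Proof.
move=> SS TT _ [k [a [b [abP ->]]]]; exists k, a, b; split=> // i.
by case: (abP i) => /SS ? /TT.
Qed.

Lemma prodI_fullr S : is_ideal S -> prodI S (@fullI A) = S.
Proof.
move=> iS; apply: eq_subI.
  by apply: prodI_sub => // x y Sx _; case: iS => _ _ SM; rewrite mulrC; apply: SM.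
by move=> x Sx; rewrite -[x]mulr1; apply: mem_prodI.
Qed.

(** This lets [prodI_sub] be applied to goals in which the element of the product ideal is
    multiplied by a fixed [y]. *)
Lemma ideal_colon U y : is_ideal U -> is_ideal (fun x => U (x * y)).
Proof.
case=> U0 UD UM; split=> [|x x' Ux Ux'|a x Ux]; first by rewrite mul0r.
  by rewrite mulrDl; apply: UD.
by rewrite -mulrA; apply: UM.
Qed.

Lemma ideal_powI S k : is_ideal S -> is_ideal (powI S k).
Proof. by move=> iS; elim: k => //= k IH; apply: ideal_prodI. Qed.

Lemma powI1 S : is_ideal S -> powI S 1 = S.
Proof.
move=> iS; apply: eq_subI => /=.
  by apply: prodI_sub => // x y _ Sy; case: iS => _ _; apply.
by move=> x Sx; rewrite -[x]mul1r; apply: mem_prodI.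
Qed.

Lemma powISl S k : is_ideal S -> powI S k.+1 = prodI S (powI S k).
Proof.
move=> iS; apply: eq_subI => /=; apply: prodI_sub; rewrite -/powI.
- exact: ideal_prodI.
- by move=> x y Px Sy; rewrite mulrC; apply: mem_prodI.
- by apply/ideal_prodI/ideal_powI.
- by move=> x y Px Sy; rewrite mulrC; apply: mem_prodI.
Qed.

Lemma powI_exp S x k : S x -> powI S k (x ^+ k).
Proof.
by move=> Sx; elim: k => //= k IH; rewrite exprSr; apply: mem_prodI.
Qed.

Lemma powI_mul S p q x y :
  is_ideal S -> powI S p x -> powI S q y -> powI S (p + q)%N (x * y).
Proof.
move=> iS Px; elim: q y => [|q IH] y Py.
  by rewrite addn0 mulrC; case: (ideal_powI p iS) => _ _; apply.
rewrite addnS mulrC; move: y Py.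
apply: (prodI_sub (ideal_colon x (ideal_powI (p + q).+1 iS))) => y s Py Ss /=.
by rewrite mulrC mulrA; apply: mem_prodI => //; apply: IH.
Qed.

Lemma powI_add S p q : is_ideal S ->
  subI (powI S (p + q)%N) (prodI (powI S p) (powI S q)).
Proof.
move=> iS; elim: q => [|q IH]; first by rewrite addn0 prodI_fullr //; apply: ideal_powI.
rewrite addnS => /=.
have iU : is_ideal (prodI (powI S p) (prodI (powI S q) S)).
  by apply/ideal_prodI/ideal_powI.
apply: prodI_sub => // x y /IH + Sy; move: x.
apply: (prodI_sub (ideal_colon y iU)) => a b Pa Pb.
by rewrite -mulrA; do 2! apply: mem_prodI => //.
Qed.

(** Recursion on the list peels off one generator at a time, as the inductions in [nakayama] and
    [spanI_exchange] require. *)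
Fixpoint spanI (xs : seq A) : A -> Prop :=
  if xs is x :: xs' then fun y => exists a z, spanI xs' z /\ y = a * x + z
  else fun y => y = 0.

Lemma ideal_spanI xs : is_ideal (spanI xs).
Proof.
elim: xs => [|x xs [S0 SD SM]] /=.
  by split=> [|_ _ -> ->|a _ ->] //=; rewrite ?addr0 ?mulr0.
split.
- by exists 0, 0; rewrite mul0r addr0.
- move=> _ _ [a [z [Sz ->]]] [a' [z' [Sz' ->]]]; exists (a + a'), (z + z').
  by split; [apply: SD | rewrite mulrDl addrACA].
- move=> c _ [a [z [Sz ->]]]; exists (c * a), (c * z).
  by split; [apply: SM | rewrite mulrDr mulrA].
Qed.

Lemma spanI_sub xs U : is_ideal U ->
  (forall x, x \in xs -> U x) -> subI (spanI xs) U.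
Proof.
move=> iU; case: (iU) => U0 UD UM.
elim: xs => [_ _ -> //|x xs IH xsU /=] _ [a [z [Sz ->]]].
apply: UD; first by apply/UM/xsU; rewrite mem_head.
by apply: IH Sz => y yxs; apply: xsU; rewrite in_cons yxs orbT.
Qed.

Lemma mem_spanI xs x : x \in xs -> spanI xs x.
Proof.
elim: xs => //= y xs IH; case: (ideal_spanI xs) => S0 _ _.
rewrite in_cons => /predU1P[->|/IH Sx]; first by exists 1, 0; rewrite mul1r addr0.
by exists 0, x; rewrite mul0r add0r.
Qed.

Lemma noetherian_spanI S : noetherian A -> is_ideal S -> exists xs, S = spanI xs.
Proof.
move=> noeA iS; have [k [g gP]] := noeA S iS; case: (iS) => S0 SD SM.
have gS i : S (g i).
  apply/gP; exists (fun j => (j == i)%:R); rewrite (bigD1 i) //= eqxx mul1r.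
  by rewrite big1 ?addr0 // => j /negPf->; rewrite mul0r.
exists (map g (enum 'I_k)); apply: eq_subI => [x /gP[c ->]|].
  case: (ideal_spanI (map g (enum 'I_k))) => T0 TD TM.
  elim/big_ind: _ => // i _; apply/TM/mem_spanI.
  by apply/map_f; rewrite mem_enum.
by apply: spanI_sub => // _ /mapP[i _ ->].
Qed.

End IdealArithmetic.

(** * Local rings: Nakayama's lemma and existence of minimal reductions modulo an ideal *)

Section LocalRing.
Local Open Scope ring_scope.
Variables (A : comNzRingType) (m : A -> Prop).
Hypothesis locA : local_ring_with m.
Implicit Types I J K L N Q : A -> Prop.

Let im : is_ideal m. Proof. by case: locA => -[]. Qed.

(** Zorn's lemma gives a maximal ideal above [J], and locality identifies it with [m]. *)
Lemma proper_sub_local J : is_ideal J -> ~ J 1 -> subI J m.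
Proof.
move=> iJ J1.
pose P : set (set A) := fun K => K = set0 \/ [/\ is_ideal K, subI J K & ~ K 1].
have [F FP Ftot|M [MP Mmax]] := @Zorn_bigcup A P.
  have [[K0 [FK0 [y0 K0y]]]|F0] := pselect (exists K, F K /\ exists y, K y); last first.
    by left; rewrite -subset0 => x [K FK Kx]; case: F0; exists K; split=> //; exists x.
  have FPne K x : F K -> K x -> [/\ is_ideal K, subI J K & ~ K 1].
    by move=> /FP[-> []|].
  right; split; first split.
  - by exists K0 => //; case: (FPne _ _ FK0 K0y) => -[].
  - move=> x y [K FK Kx] [L FL Ly].
    have [KL|LK] := Ftot _ _ FK FL.
      exists L => //; case: (FPne _ _ FL Ly) => -[_ LD _] _ _.
      by apply: LD => //; apply: KL.
    exists K => //; case: (FPne _ _ FK Kx) => -[_ KD _] _ _.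
    by apply: KD => //; apply: LK.
  - move=> a x [K FK Kx]; exists K => //; case: (FPne _ _ FK Kx) => -[_ _ KM] _ _.
    exact: KM.
  - by move=> x Jx; exists K0 => //; case: (FPne _ _ FK0 K0y) => _ JK0 _; apply: JK0.
  - by move=> [K FK K1]; case: (FPne _ _ FK K1).
have PJ : P J by right; split.
case: MP => [M0|[iM JM M1]].
  by case: (Mmax J) => //; rewrite M0; split=> // /(_ 0); apply; case: iJ.
have maxM : is_max_ideal M.
  split=> // K iK MK K1 x Kx; apply: contrapT => Mx.
  apply: (Mmax K); last by right; split=> // y /JM /MK.
  by split=> // /(_ x Kx).
by case: locA => _ /(_ M maxM) Mm x /JM /Mm.
Qed.

(** Otherwise the principal ideal of [x] would be proper, hence contained in [m]. *)
Lemma local_unit x : ~ m x -> exists y, y * x = 1.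
Proof.
move=> mx; apply: contrapT => nux.
have iX : is_ideal (fun z => exists y, z = y * x).
  split; first by exists 0; rewrite mul0r.
    by move=> _ _ [y ->] [z ->]; exists (y + z); rewrite mulrDl.
  by move=> a _ [y ->]; exists (a * y); rewrite mulrA.
apply: mx; apply: (proper_sub_local iX); last by exists 1; rewrite mul1r.
by move=> [y yx]; apply: nux; exists y.
Qed.

Lemma local_unit1B x : m x -> exists y, y * (1 - x) = 1.
Proof.
move=> mx; apply: local_unit => m1x; case: locA => -[_ + _] _; apply.
by rewrite -(subrK x 1); case: im => _ mD _; apply: mD.
Qed.

Lemma local_prime x y : m (x * y) -> m x \/ m y.
Proof.
move=> mxy; have [|/local_unit[z zx]] := pselect (m x); [by left|right].
by rewrite -[y]mul1r -zx -mulrA; case: im => _ _; apply.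
Qed.

Lemma local_prime_exp x k : m (x ^+ k) -> m x.
Proof.
elim: k => [|k IH]; first by case: locA => -[_ + _] _ => /[apply].
by rewrite exprS => /local_prime[|/IH].
Qed.

(** Gaussian elimination on the list: the relation for the head reads [(1 - a) * x] in [K + m (xs)]
    with [a] in [m], and [1 - a] is a unit. Substituting for [x] in the other relations gives the
    same hypothesis for the tail. *)
Lemma nakayama K xs : is_ideal K ->
  (forall x, x \in xs -> addI K (prodI m (spanI xs)) x) ->
  forall x, x \in xs -> K x.
Proof.
move=> iK; elim: xs => // x xs IH hxs.
have iS := ideal_spanI xs; have ipS := ideal_prodI (spanI xs) im.
have iKS := ideal_addI iK ipS.
have prod_cons y : prodI m (spanI (x :: xs)) y ->
    exists a z, [/\ m a, prodI m (spanI xs) z & y = a * x + z].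
  move: y; apply: prodI_sub; last first.
    move=> a _ ma [b [z [Sz ->]]]; exists (a * b), (a * z); split.
    - by rewrite mulrC; case: im => _ _; apply.
    - exact: mem_prodI.
    - by rewrite mulrDr mulrA.
  case: im ipS => m0 mD mM [p0 pD pM]; split.
  - by exists 0, 0; rewrite mul0r addr0.
  - move=> _ _ [a [z [ma Sz ->]]] [a' [z' [ma' Sz' ->]]]; exists (a + a'), (z + z').
    by split; [apply: mD | apply: pD | rewrite mulrDl addrACA].
  - move=> c _ [a [z [ma Sz ->]]]; exists (c * a), (c * z).
    by split; [apply: mM | apply: pM | rewrite mulrDr mulrA].
have xKS : addI K (prodI m (spanI xs)) x.
  have [k [_ [Kk /prod_cons[a [z [ma Sz ->]]] xE]]] := hxs x (mem_head _ _).
  have [u u1] := local_unit1B ma.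
  have -> : x = u * (k + z).
    rewrite -[LHS]mul1r -u1 -mulrA; congr (_ * _).
    by rewrite mulrBl mul1r {1}xE; ring.
  case: iKS => _ _; apply; exists k, z; split=> //.
have xsK y : y \in xs -> K y.
  apply: IH => {}y yxs.
  have [|k [_ [Kk /prod_cons[a [z [ma Sz ->]]] ->]]] := hxs y.
    by rewrite in_cons yxs orbT.
  case: iKS => _ KSD KSM; apply: (KSD); first exact: addI_subl.
  by apply: KSD; [apply: KSM | apply: addI_subr].
move=> y; rewrite in_cons => /predU1P[->|]; last exact: xsK.
move: xKS; apply: addI_sub => // z; apply: prodI_sub => // a b _ Sb.
by case: (iK) => _ _; apply; apply: (spanI_sub iK xsK).
Qed.

(* Modulo [N] the ideal [K] is a subspace of a vector space spanned by [xs], so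
   it is either everything or spanned by fewer than [size xs] elements. *)
Lemma spanI_exchange K N xs : is_ideal K -> is_ideal N ->
  subI K (addI (spanI xs) N) -> (forall x a, x \in xs -> m a -> N (a * x)) ->
  (forall x, x \in xs -> addI K N x) \/
  exists ys, [/\ (size ys < size xs)%N, forall y, y \in ys -> K y &
                 subI K (addI (spanI ys) N)].
Proof.
move=> iK; elim: xs N => [|x xs IH] N iN; first by left.
case: (iK) (iN) (ideal_spanI xs) => K0 KD KM [N0 ND NM] [S0 SD SM].
move=> KS mN.
have mNxs y a : y \in xs -> m a -> N (a * y).
  by move=> yxs; apply: mN; rewrite in_cons yxs orbT.
(* Either some element [y] of [K] has a unit coefficient at the head [x], and [y] can replace [x] as
   a generator; or all these coefficients lie in [m], their multiples of [x] fall into [N], and [K]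
   lies in the span of the tail modulo [N]. *)
have [[y [a [z [n [Ky [Sz Nn yE] ma]]]]]|nunit] :=
  pselect (exists y a z n, [/\ K y, [/\ spanI xs z, N n & y = a * x + z + n] & ~ m a]).
- have [u ua] := local_unit ma.
  have xE : x = u * y - u * z - u * n by rewrite yE -[LHS]mul1r -ua; ring.
  (* The induction hypothesis is used modulo [N']. Since [y] is in [K], this does not enlarge
     [K + N], and [y] is put back in front of the list at the end. *)
  pose N' := addI (spanI [:: y]) N.
  have iN' : is_ideal N' by apply: ideal_addI => //; apply: ideal_spanI.
  have yN' : N' y by apply: addI_subl => //; apply: mem_spanI; rewrite mem_head.
  have NN' : subI N N' by apply/addI_subr/ideal_spanI.
  have KN' : subI (addI K N') (addI K N).
    have iKN := ideal_addI iK iN.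
    apply: addI_sub => //; first exact: addI_subl.
    apply: addI_sub => //; last exact: addI_subr.
    apply: spanI_sub => // _ /[!inE] /eqP->; exact: addI_subl.
  have [|w b wxs mb|xsK|[ys [ltys ysK Kys]]] := IH N' iN'.
  + move=> w Kw; have [_ [n' [[b [z' [Sz' ->]]] Nn' ->]]] := KS w Kw.
    exists (z' - b * u * z), (b * u * y + (n' - b * u * n)); split.
    * by apply: idealB (ideal_spanI xs) _ _ => //; apply: SM.
    * exists (b * u * y), (n' - b * u * n); split=> //.
        by exists (b * u), 0; rewrite addr0.
      by apply: idealB => //; apply: NM.
    * by rewrite xE; ring.
  + by apply/NN'/mNxs.
  + left=> w; rewrite in_cons => /predU1P[->|wxs]; last by apply/KN'/xsK.
    case: (ideal_addI iK iN) => Q0 QD QM.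
    have zK : addI K N z.
      by move: z Sz {yE xE}; apply: spanI_sub => // v /xsK/KN'.
    rewrite xE; apply: idealB; rewrite //; last by apply/QM/addI_subr.
    by apply: idealB => //; [apply/QM/addI_subl | apply: QM].
  + right; exists (y :: ys); split=> // [v /[!inE] /predU1P[->|/ysK]//|v /Kys].
    move=> [s [_ [Ss [_ [n' [[b [_ [-> ->]]] Nn' ->]]] ->]]].
    exists (b * y + s), n'; split=> //; first by exists b, s.
    by ring.
- have KSxs : subI K (addI (spanI xs) N).
    move=> w Kw; have [_ [n [[a [z [Sz ->]]] Nn wE]]] := KS w Kw.
    exists z, (a * x + n); split=> //; last by rewrite wE; ring.
    apply: ND => //; apply: mN; first exact: mem_head.
    by apply: contrapT => ma; apply: nunit; exists w, a, z, n.
  have [xsK|[ys [ltys ysK Kys]]] := IH N iN KSxs mNxs; last first.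
    by right; exists ys; split=> //; apply: ltnW.
  (* Here [K + N] contains the whole tail: each generator is replaced by an element of [K] congruent
     to it modulo [N], and the list is shorter by the dropped head. *)
  have [v|f fP] := @choice A A (fun v w => v \in xs -> K w /\ N (v - w)).
    have [/xsK[k [n [Kk Nn ->]]]|vxs] := boolP (v \in xs); last by exists 0.
    by exists k; split=> //; rewrite addrC addKr.
  right; exists (map f xs); rewrite size_map; split=> //.
    by move=> _ /mapP[v /fP[Kv _] ->].
  move=> w /KSxs; have iT := ideal_spanI (map f xs).
  have iTN := ideal_addI iT iN.
  apply: addI_sub => //; last exact: addI_subr.
  apply: spanI_sub => // v vxs; exists (f v), (v - f v).
  by split; [apply/mem_spanI/map_f | case: (fP v vxs) | rewrite addrC subrK].
Qed.

(* The three predicates below describe the reductions of the maximal ideal of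
   [A / I] through their preimages [Q] in [A]. *)
Definition redeq I Q r := subI (powI m r.+1) (addI (prodI Q (powI m r)) I).

Definition relred I Q :=
  [/\ is_ideal Q, subI I Q, subI Q m & exists r, redeq I Q r].

Definition minred I Q := relred I Q /\ forall J, relred I J -> subI J Q -> J = Q.

Lemma redeqS I I' Q Q' r :
  subI I I' -> subI Q Q' -> redeq I Q r -> redeq I' Q' r.
Proof.
move=> II QQ red x /red[y [z [Qy Iz ->]]]; exists y, z; split=> //; last exact: II.
exact: prodIS Qy.
Qed.

(** The part of the product coming from the summand [I] is absorbed by the error term [I]. *)
Lemma redeq_addI I Q r : is_ideal I -> is_ideal Q ->
  redeq I (addI Q I) r -> redeq I Q r.
Proof.
move=> iI iQ red x /red; have iP := ideal_addI (ideal_prodI (powI m r) iQ) iI.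
move: x; apply: addI_sub => //; last exact/addI_subr/ideal_prodI.
apply: prodI_sub => // _ p [q [i [Qq Ii ->]]] mp; rewrite mulrDl.
exists (q * p), (i * p); split=> //; first exact: mem_prodI.
by rewrite mulrC; case: iI => _ _; apply.
Qed.

Lemma prod_powI_sub Q r : subI Q m -> subI (prodI Q (powI m r)) (powI m r.+1).
Proof. by move=> Qm; rewrite powISl //; apply: prodIS. Qed.

(** Write [x = w + i] and [y = v + j] with [w], [v] in the products with [Q]. Then [i = x - w] is
    again in [m^(r+1)], and [x * y = w * y + v * i + i * j], where only [i * j] is an error term,
    lying in [L]. *)
Lemma redeq_mul I J L Q r s : is_ideal L -> is_ideal Q -> subI Q m ->
  subI (prodI I J) L -> redeq I Q r -> redeq J Q s -> redeq L Q (r + s).+1.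
Proof.
move=> iL iQ Qm IJL redI redJ.
have iW : is_ideal (prodI Q (powI m (r + s).+1)) by apply: ideal_prodI.
have iU := ideal_addI iW iL.
have mulW a b q p : powI m a b -> prodI Q (powI m p) q -> (a + p)%N = (r + s).+1 ->
    prodI Q (powI m (r + s).+1) (q * b).
  move=> mb + <-; move: q; apply: prodI_sub.
    exact/ideal_colon/ideal_prodI.
  by move=> c d Qc md; rewrite -mulrA; apply: mem_prodI; rewrite // mulrC; apply: powI_mul.
rewrite /redeq (_ : (r + s).+2 = r.+1 + s.+1)%N; last by rewrite addSn addnS.
move=> x /(powI_add im); move: x.
apply: prodI_sub => // x y mx my.
have [w [i [Ww Ii xE]]] := redI _ mx; have [v [j [Vv Jj yE]]] := redJ _ my.
have mi : powI m r.+1 i.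
  rewrite -(addKr w i) -xE addrC; apply: idealB => //; first exact: ideal_powI.
  exact: prod_powI_sub Ww.
have -> : x * y = w * y + v * i + i * j by rewrite xE yE; ring.
exists (w * y + v * i), (i * j); split=> //; last exact/IJL/mem_prodI.
case: iW => _ WD _; apply: WD.
  by apply: mulW my Ww _; rewrite addSn addnC.
by apply: mulW mi Vv _; rewrite addSn.
Qed.

(** Induction on the number of generators modulo [I]. A reduction [K] inside [J = (xs) + I] is
    compared with [J] modulo [m J + I]: either [K] fills [J] and Nakayama gives [K = J], or fewer
    elements [ys] of [K] span it there, and [(ys) + I] is still a reduction. *)
Lemma exists_minred I Q : noetherian A -> is_ideal I -> relred I Q ->
  exists2 J, minred I J & subI J Q.
Proof.
move=> noeA iI relQ; have [iQ IQ Qm _] := relQ.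
have [xs QE] := noetherian_spanI noeA iQ.
have : relred I (addI (spanI xs) I) /\ subI (addI (spanI xs) I) Q.
  have sQ : subI (addI (spanI xs) I) Q by apply: addI_sub; rewrite // -QE.
  split=> //; suff -> : addI (spanI xs) I = Q by [].
  by apply: eq_subI => //; rewrite {1}QE; apply: addI_subl.
move En : (size xs) => n; elim/ltn_ind: n xs En {QE} => n IHn xs En [relJ JQ].
set J := addI (spanI xs) I in relJ JQ *; have [iJ IJ Jm _] := relJ.
(* If no minimal reduction below [Q] existed, [J] itself would be shown to be one: a [K] different
   from [J] would lead to a shorter list of generators. *)
have [//|noys] := pselect (exists2 J, minred I J & subI J Q).
exists J => //; split=> // K [iK IK Km [r redK]] KJ.
pose N := addI (prodI m J) I.
have iN : is_ideal N by apply/ideal_addI/iI/ideal_prodI.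
have iS := ideal_spanI xs.
have KN : subI K (addI (spanI xs) N).
  move=> k /KJ[s [i [Ss Ii ->]]]; exists s, i; split=> //.
  by apply: addI_subr => //; apply: ideal_prodI.
have mN x a : x \in xs -> m a -> N (a * x).
  move=> xxs ma; apply: addI_subl => //; apply: mem_prodI => //.
  by apply: addI_subl => //; apply: mem_spanI.
have [xsK|[ys [ltys ysK Kys]]] := spanI_exchange iK iN KN mN.
  apply: eq_subI => //; apply: addI_sub => //; apply: spanI_sub => //.
  apply: nakayama => // x /xsK; have iR := ideal_addI iK (ideal_prodI (spanI xs) im).
  move: x; apply: addI_sub => //; first exact/addI_subl/ideal_prodI.
  apply: addI_sub => //; last by move=> i /IK; apply/addI_subl/ideal_prodI.
  apply: prodI_sub => // a _ ma [s [i [Ss Ii ->]]]; rewrite mulrDr addrC.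
  exists (a * i), (a * s); split=> //; last exact: mem_prodI.
  by case: (iK) => _ _; apply; apply: IK.
case: noys; apply: (IHn (size ys)) (erefl _) _; first by rewrite -En.
have iT := ideal_spanI ys; set J' := addI (spanI ys) I.
have iJ' : is_ideal J' by apply: ideal_addI.
have J'K : subI J' K by apply: addI_sub => //; apply: spanI_sub.
split; last by move=> x /J'K /KJ /JQ.
split=> //; [exact: addI_subr | by move=> x /J'K /Km | exists r].
(* The exponent [r] of [K] also serves for [J']: as [K] lies in [J' + m J], the power [m^(r+1)] lies
   in [J' m^r + I + m m^(r+1)], and Nakayama removes the last term. *)
have [gs gsE] := noetherian_spanI noeA (ideal_powI r.+1 im).
pose K' := addI (prodI J' (powI m r)) I.
have iK' : is_ideal K' by apply/ideal_addI/iI/ideal_prodI.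
have iP : is_ideal (prodI m (powI m r.+1)) by apply: ideal_prodI.
have iR := ideal_addI iK' iP.
rewrite /redeq -/K' gsE; apply: spanI_sub => //; apply: nakayama => // g /mem_spanI.
rewrite -gsE => /redK; move: g; apply: addI_sub => //; last first.
  by move=> i Ii; apply: addI_subl => //; apply: addI_subr => //; apply: ideal_prodI.
apply: prodI_sub => // k p Kk mp; have iRp := ideal_colon p iR.
move: k {Kk}(Kys k Kk); apply: addI_sub => //.
  move=> s Ss; apply: addI_subl => //; apply: addI_subl => //; apply: mem_prodI => //.
  exact: addI_subl.
apply: addI_sub => // [|i Ii]; last first.
  apply: addI_subl => //; apply: addI_subr; first exact: ideal_prodI.
  by rewrite mulrC; case: iI => _ _; apply.
apply: prodI_sub => // a b ma Jb; apply: addI_subr => //; rewrite -mulrA.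
by apply: mem_prodI => //; rewrite mulrC; apply: mem_prodI => //; apply: Jm.
Qed.

End LocalRing.

(** * The reduction number as an attained minimum *)

Section ReductionNumber.
Variables (A : comNzRingType) (n : A -> Prop).

(** One minimal reduction with some exponent suffices: the least exponent over all minimal
    reductions satisfies [is_r], so the default value 0 in [r_num] is excluded. *)
Lemma r_numP : (exists q r, is_minimal_reduction n q /\ reduction_eq n q r) ->
  (exists q, is_minimal_reduction n q /\ reduction_eq n q (r_num n)) /\
  (forall q s, is_minimal_reduction n q -> reduction_eq n q s -> (r_num n <= s)%N).
Proof.
pose P r := `[< exists q, is_minimal_reduction n q /\ reduction_eq n q r >].
move=> [q0 [r0 qr0]].
have exP : exists r, P r by exists r0; apply/asboolP; exists q0.
case: (ex_minnP exP) => r /asboolP[q [minq redq]] minr.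
have isr : is_r n r.
  split; first by exists q; split=> //; split=> // s reds; apply/minr/asboolP; exists q.
  by move=> q' s minq' [reds _]; apply/minr/asboolP; exists q'.
rewrite /r_num; case: pselect => [ex|]; last by case; exists r.
case: (cid _) => v [[q1 [minq1 [redq1 _]]] minv] /=; split; first by exists q1.
have rv : (v <= r)%N.
  by apply: (minv q) => //; split=> // s reds; apply/minr/asboolP; exists q.
move=> q' s minq' reds; apply: (leq_trans rv); apply/minr/asboolP; by exists q'.
Qed.

End ReductionNumber.

(** * Transfer of reductions along a surjection with kernel [I] *)

Section Quotient.
Local Open Scope ring_scope.
Variables (A B : comNzRingType) (f : {rmorphism A -> B}) (m I : A -> Prop).
Hypothesis locA : local_ring_with m.
Hypothesis f_surj : forall y, exists x, f x = y.
Hypothesis kerf : forall x, I x <-> f x = 0.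
Implicit Types (S T J : A -> Prop) (q : B -> Prop).

Let im : is_ideal m. Proof. by case: locA => -[]. Qed.

Definition img S : B -> Prop := fun y => exists x, S x /\ f x = y.
Definition pre q : A -> Prop := fun x => q (f x).

Let iI : is_ideal I.
Proof.
split; first by apply/kerf; rewrite rmorph0.
  by move=> x y /kerf fx /kerf fy; apply/kerf; rewrite rmorphD fx fy addr0.
by move=> a x /kerf fx; apply/kerf; rewrite rmorphM fx mulr0.
Qed.

Let Im : subI I m.
Proof.
by apply: (proper_sub_local locA) => // /kerf/eqP; rewrite rmorph1 oner_eq0.
Qed.

Lemma ideal_pre q : is_ideal q -> is_ideal (pre q).
Proof.
case=> q0 qD qM; rewrite /pre; split; first by rewrite rmorph0.
  by move=> x y qx qy; rewrite rmorphD; apply: qD.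
by move=> a x qx; rewrite rmorphM; apply: qM.
Qed.

Lemma ideal_img S : is_ideal S -> is_ideal (img S).
Proof.
case=> S0 SD SM; split; first by exists 0; rewrite rmorph0.
  move=> _ _ [x [Sx <-]] [y [Sy <-]]; exists (x + y); rewrite rmorphD.
  by split=> //; apply: SD.
move=> b _ [x [Sx <-]]; have [a <-] := f_surj b; exists (a * x); rewrite rmorphM.
by split=> //; apply: SM.
Qed.

Lemma img_eq S x : is_ideal S -> subI I S -> img S (f x) -> S x.
Proof.
move=> iS IS [y [Sy fyx]]; rewrite -(subrK y x); case: (iS) => _ SD _.
by apply: SD => //; apply/IS/kerf; rewrite rmorphB fyx subrr.
Qed.

Lemma preK q : img (pre q) = q.
Proof.
apply: eq_subI => [_ [x [qx <-]] //|y qy].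
by have [x fx] := f_surj y; exists x; rewrite /pre fx.
Qed.

Lemma imgK S : is_ideal S -> subI I S -> pre (img S) = S.
Proof.
by move=> iS IS; apply: eq_subI => x; [apply: img_eq | move=> Sx; exists x].
Qed.

Lemma img_prodI S T : is_ideal S -> is_ideal T ->
  prodI (img S) (img T) = img (prodI S T).
Proof.
move=> iS iT; have iST := ideal_prodI T iS; apply: eq_subI.
  apply: prodI_sub; first exact: ideal_img.
  move=> _ _ [x [Sx <-]] [y [Ty <-]]; exists (x * y); rewrite rmorphM.
  by split=> //; apply: mem_prodI.
move=> _ [x [STx <-]]; move: x STx; rewrite -/(subI _ (pre (prodI (img S) (img T)))).
apply: prodI_sub; first exact/ideal_pre/ideal_prodI/ideal_img.
move=> x y Sx Ty; rewrite /pre rmorphM.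
by apply: mem_prodI; [exists x | exists y].
Qed.

Lemma img_powI k : powI (img m) k = img (powI m k).
Proof.
elim: k => [|k IH] /=; last by rewrite IH img_prodI //; apply: ideal_powI.
by apply: eq_subI => // y _; have [x <-] := f_surj y; exists x.
Qed.

(** The inclusion of [q n^r] in [n^(r+1)] follows from [qm]; the other one, pulled back along [f],
    acquires the summand [I] from the kernel. *)
Lemma reduction_eqP q r : is_ideal q -> subI q (img m) ->
  reduction_eq (img m) q r <-> redeq m I (pre q) r.
Proof.
move=> iq qm; have iQ := ideal_pre iq; have imr := ideal_powI r im.
have prodE : prodI q (powI (img m) r) = img (prodI (pre q) (powI m r)).
  by rewrite -{1}(preK q) img_powI img_prodI.
rewrite /reduction_eq prodE img_powI; split=> [eqr x mx|redr y].
  have [|y [Py fyx]] := (eqr (f x)).1; first by exists x.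
  exists y, (x - y); split=> //; last by rewrite addrC subrK.
  by apply/kerf; rewrite rmorphB fyx subrr.
split=> [[x [/redr[w [i [Pw /kerf fi ->]]] <-]]|].
  by exists w; rewrite rmorphD fi addr0.
rewrite -img_powI -prodE powISl; first by apply: prodIS.
exact: ideal_img.
Qed.

(** From right to left, [q] must be shown primary with radical the maximal ideal: [redeq] puts
    [m^(r+1)] inside [Q], and elements outside the maximal ideal are units. *)
Lemma is_reductionP q :
  is_reduction (img m) q <-> is_ideal q /\ relred m I (pre q).
Proof.
split=> [[[[iq q1 _] _] qm [r redr]]|[iq [iQ IQ Qm [r redr]]]].
  split=> //; split; first exact: ideal_pre.
  - by move=> x /kerf fx; rewrite /pre fx; case: iq.
  - by move=> x /qm; apply: img_eq.
  - by exists r; apply/(reduction_eqP _ iq qm).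
have qm : subI q (img m).
  by move=> y; have [x <-] := f_surj y => qx; exists x; split=> //; apply: Qm.
have m1 : ~ m 1 by case: locA => -[].
have radq y : img m y -> radicalI q y.
  move=> [x [mx <-]]; exists r.+1; rewrite -rmorphXn.
  have /redr[w [i [Pw Ii ->]]] := powI_exp r.+1 mx.
  case: (iQ) => _ QD QM; apply: QD; last exact: IQ.
  move: w Pw; apply: prodI_sub => // a b Qa _.
  by rewrite mulrC; apply: QM.
split=> //; last by exists r; apply/reduction_eqP.
split.
  split=> // [q1|x y qxy qx].
    by apply: m1; apply: Qm; rewrite /pre rmorph1.
  apply: radq; have [b fb] := f_surj y.
  have [mb|/(local_unit locA)[c cb]] := pselect (m b); first by exists b.
  case: qx; case: iq => _ _ qM; have := qM (f c) _ qxy.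
  by rewrite -fb mulrCA -rmorphM cb rmorph1 mulr1.
move=> y; split=> [[k qyk]|/radq //]; have [x fx] := f_surj y.
exists x; split=> //; apply: (local_prime_exp locA) (k) _.
by apply: Qm; rewrite /pre rmorphXn fx.
Qed.

(** [img] and [pre] are mutually inverse, inclusion-preserving maps between ideals containing [I]
    and ideals of [B], so minimality transfers. *)
Lemma is_minimal_reductionP q :
  is_minimal_reduction (img m) q <-> is_ideal q /\ minred m I (pre q).
Proof.
split=> [[/is_reductionP[iq redq] minq]|[iq [redq minq]]].
  split=> //; split=> // J redJ Jq; have [iJ IJ _ _] := redJ.
  rewrite -{1}(imgK iJ IJ); congr pre; apply/eqI_eq/minq; last first.
    by move=> _ [x [/Jq ? <-]].
  by apply/is_reductionP; rewrite imgK //; split=> //; apply: ideal_img.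
split; first exact/is_reductionP.
move=> q' /is_reductionP[iq' redq'] q'q; rewrite -(preK q') -(preK q).
by rewrite (minq _ redq') // => x; apply: q'q.
Qed.

Lemma r_num_attained : noetherian A ->
  exists Q, minred m I Q /\ redeq m I Q (r_num (img m)).
Proof.
move=> noeA.
(* The search starts from [m], a reduction of itself with exponent 0. *)
have [|Q minQ _] := exists_minred locA noeA iI (Q := m).
  split=> //; exists 0%N; rewrite /redeq powI1 //= prodI_fullr //.
  exact: addI_subl.
have [[iQ IQ Qm [r redQ]] _] := minQ.
have [|[q [/is_minimal_reductionP[iq minq] redq]] _] := @r_numP _ (img m).
  have iq := ideal_img iQ; exists (img Q), r; split.
    by apply/is_minimal_reductionP; rewrite imgK.
  apply/reduction_eqP; rewrite ?imgK //.
  by move=> _ [x [/Qm mx <-]]; exists x.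
exists (pre q); split=> //; apply/reduction_eqP => //.
case: minq => -[_ _ Qm' _] _ y; have [x <-] := f_surj y => qx.
by exists x; split=> //; apply: Qm'.
Qed.

Lemma r_num_le Q s : minred m I Q -> redeq m I Q s -> (r_num (img m) <= s)%N.
Proof.
move=> minQ redQ; have [[iQ IQ Qm _] _] := minQ; have iq := ideal_img iQ.
have minq : is_minimal_reduction (img m) (img Q).
  by apply/is_minimal_reductionP; rewrite imgK.
have redq : reduction_eq (img m) (img Q) s.
  apply/reduction_eqP; rewrite ?imgK //.
  by move=> _ [x [/Qm mx <-]]; exists x.
have [|_ ler] := @r_numP _ (img m); first by exists (img Q), s.
exact: ler redq.
Qed.

End Quotient.

(** * Comparing minimal reductions modulo different members of a filtration *)

Section Filtration.
Local Open Scope ring_scope.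
Variables (A : comNzRingType) (m : A -> Prop) (I : nat -> A -> Prop).
Hypotheses (noeA : noetherian A) (locA : local_ring_with m).
Hypothesis iI : forall k, is_ideal (I k).
Hypothesis Im : forall k, (1 <= k)%N -> subI (I k) m.
Hypothesis decI : forall k, (1 <= k)%N -> subI (I k.+1) (I k).
Hypothesis mulI : forall a b, (1 <= a)%N -> (1 <= b)%N ->
  subI (prodI (I a) (I b)) (I (a + b)%N).

Lemma filtrationS a b : (1 <= a)%N -> (a <= b)%N -> subI (I b) (I a).
Proof.
move=> a0 /subnK<-; elim: (b - a)%N => [|k IH]; first by rewrite add0n.
rewrite addSn => x /decI Ix; apply: IH; apply: Ix; exact: leq_trans (leq_addl _ _).
Qed.

(** In [redeq_mul] the exponents increased by one add up, so the exponent plus one gets multiplied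
    by [k.+1]; hence the predecessor. *)
Lemma redeq_filtration Q a k r : is_ideal Q -> subI Q m -> (1 <= a)%N ->
  redeq m (I a) Q r -> redeq m (I (a * k.+1)%N) Q (r.+1 * k.+1).-1.
Proof.
move=> iQ Qm a0 red; elim: k => [|k IH]; first by rewrite !muln1.
have -> : ((r.+1 * k.+2).-1 = ((r.+1 * k.+1).-1 + r).+1)%N by lia.
rewrite mulnSr; apply: redeq_mul IH red => //.
by apply: mulI; rewrite ?muln_gt0 ?a0.
Qed.

(** Since [I (a * b)] is contained in [I b], a reduction equation modulo [I a] gives one modulo
    [I b], even for [b] larger than [a]. *)
Lemma relred_filtration J a b : (1 <= a)%N -> (1 <= b)%N ->
  is_ideal J -> subI (I b) J -> subI J m -> (exists r, redeq m (I a) J r) ->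
  relred m (I b) J.
Proof.
move=> a0 b0 iJ IJ Jm [r red]; split=> //; exists (r.+1 * b).-1.
have := redeq_filtration (k := b.-1) iJ Jm a0 red; rewrite prednK //.
by apply: redeqS => //; apply: filtrationS => //; rewrite leq_pmull.
Qed.

(** Let [J] be a reduction modulo [I a] inside [Q + I a]. By the modular law [J] lies in the sum of
    [I a] and the intersection of [J] with [Q]. So this intersection is a reduction modulo [I b],
    and minimality of [Q] makes it all of [Q]. *)
Lemma minred_down Q a b : (1 <= a)%N -> (a <= b)%N ->
  minred m (I b) Q -> minred m (I a) (addI Q (I a)).
Proof.
move=> a0 ab [[iQ IQ Qm [r red]] minQ].
have b0 : (1 <= b)%N by apply: leq_trans ab.
have Iba := filtrationS a0 ab.
split.
  split; [exact: ideal_addI | exact: addI_subr | |].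
    by apply: addI_sub => //; [case: locA => -[] | apply: Im].
  by exists r; apply: redeqS red => //; apply: addI_subl.
move=> J [iJ IJ Jm [s redJ]] JQ; case: (iJ) (iQ) => J0 JD JM [Q0 QD QM].
pose J' x := J x /\ Q x.
have iJ' : is_ideal J'.
  split=> // [x y [Jx Qx] [Jy Qy]|c x [Jx Qx]]; first by split; [apply: JD | apply: QD].
  by split; [apply: JM | apply: QM].
have JJ' : subI J (addI J' (I a)).
  move=> x Jx; have [q [i [Qq Ii xE]]] := JQ x Jx; exists q, i; split=> //.
  split=> //; rewrite -(addrK i q) -xE; apply: idealB => //; exact: IJ.
have J'Q : J' = Q.
  apply: minQ => [|x [] //]; apply: (relred_filtration a0 b0 iJ').
  - by move=> x Ix; split; [apply/IJ/Iba | apply: IQ].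
  - by move=> x [/Jm].
  - by exists s; apply: redeq_addI => //; apply: redeqS redJ.
by apply: eq_subI => //; apply: addI_sub => // x; rewrite -J'Q => -[].
Qed.

(** Take [J] inside [Q], minimal modulo [I (a * k.+1)]. Minimality of [Q] forces [J + I a = Q], so
    [J] inherits the exponent [r] modulo [I a], which [redeq_filtration] then multiplies. *)
Lemma minred_up Q a k r : (1 <= a)%N -> minred m (I a) Q -> redeq m (I a) Q r ->
  exists J, minred m (I (a * k.+1)%N) J /\ redeq m (I (a * k.+1)%N) J (r.+1 * k.+1).-1.
Proof.
move=> a0 [[iQ IQ Qm _] minQ] redQ.
have ak0 : (1 <= a * k.+1)%N by rewrite muln_gt0 a0.
have Iak : subI (I (a * k.+1)%N) (I a) by apply: filtrationS; rewrite ?leq_pmulr.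
have [|J minJ JQ] := exists_minred locA noeA (iI (a * k.+1)%N) (Q := Q).
  by apply: (relred_filtration a0 ak0) => // [x /Iak/IQ//|]; exists r.
have [[iJ IJ Jm [s redJ]] _] := minJ.
have JE : addI J (I a) = Q.
  apply: minQ; last exact: addI_sub.
  split; [exact: ideal_addI | exact: addI_subr | by move=> x /(addI_sub iQ JQ IQ)/Qm |].
  by exists s; apply: redeqS redJ => //; apply: addI_subl.
exists J; split=> //; apply: redeq_filtration => //.
by apply: redeq_addI => //; rewrite JE.
Qed.

End Filtration.

(** * Convergence of [u k / k] for a monotone [u] with [u (a k) <= k u a] *)

Section RationalGrowth.
Import Reals Lra.
Local Open Scope R_scope.
Local Open Scope nat_scope.
Variable u : nat -> nat.
Hypothesis u_homo : forall a b, 1 <= a -> a <= b -> u a <= u b.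
Hypothesis u_mul : forall a k, 1 <= a -> u (a * k.+1) <= u a * k.+1.

(* The limit is [inf u k / k]: writing [k] between multiples of [a] gives
   [u k <= (k / a + 1) u a]. *)
Lemma growth_limit : exists c : R,
  Un_cv (fun k => (INR (u k.+1) - 1) / INR k.+1)%R c /\
  forall k, 1 <= k -> (c * INR k <= INR (u k))%R.
Proof.
have pos k : (0 < INR k.+1)%R by apply: lt_0_INR; lia.
(* Negated quotients, since [completeness] provides suprema: the infimum is [- d]. *)
pose E x := exists k, x = (- (INR (u k.+1) / INR k.+1))%R.
have [||d [dub dlub]] := completeness E.
- exists 0%R => _ [k ->].
  have := Rmult_le_pos _ _ (pos_INR (u k.+1)) (Rlt_le _ _ (Rinv_0_lt_compat _ (pos k))).
  by rewrite /Rdiv; lra.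
- by exists (- (INR (u 1) / INR 1))%R; exists 0.
have lb k : (- d * INR k.+1 <= INR (u k.+1))%R.
  have : (- (INR (u k.+1) / INR k.+1) <= d)%R by apply: dub; exists k.
  have := pos k => p h.
  have -> : INR (u k.+1) = (INR (u k.+1) / INR k.+1 * INR k.+1)%R by field; lra.
  by apply: Rmult_le_compat_r; lra.
exists (- d)%R; split; last by case.
move=> eps eps0.
have [a ha] : exists a, (INR (u a.+1) / INR a.+1 < - d + eps / 2)%R.
  apply: contrapT => na; suff : (d <= d - eps / 2)%R by lra.
  apply: dlub => _ [k ->]; apply: Rnot_lt_le => h; apply: na; exists k; lra.
(* Past this bound [(u a.+1 + 1) / k.+1 < eps / 2]: the term [u a.+1] pays for rounding [k.+1] up to
   a multiple of [a.+1], and the 1 for the [- 1] in the numerator. *)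
have [N hN] := INR_unbounded ((INR (u a.+1) + 1) * 2 / eps).
exists N => k kN; rewrite /Rdist.
have p := pos k; have l := lb k.
have kbig : ((INR (u a.+1) + 1) * 2 < eps * INR k.+1)%R.
  have : (INR N < INR k.+1)%R by apply: lt_INR; lia.
  move=> h; have h2 : ((INR (u a.+1) + 1) * 2 / eps < INR k.+1)%R by lra.
  have -> : ((INR (u a.+1) + 1) * 2 = eps * ((INR (u a.+1) + 1) * 2 / eps))%R.
    by field; lra.
  exact: Rmult_lt_compat_l.
have up : (INR (u k.+1) <= INR (u a.+1) / INR a.+1 * INR k.+1 + INR (u a.+1))%R.
  pose n := k.+1 %/ a.+1.
  have un : u k.+1 <= u a.+1 * n.+1.
    apply: leq_trans (u_mul n _) => //; apply: u_homo => //.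
    by rewrite mulnC; apply/ltnW/ltn_ceil.
  have na : n * a.+1 <= k.+1 by apply: leq_trunc_div.
  have {}un : (INR (u k.+1) <= INR (u a.+1) * (INR n + 1))%R.
    by rewrite -S_INR -mult_INR; apply: le_INR; apply/leP.
  have {}na : (INR n * INR a.+1 <= INR k.+1)%R.
    by rewrite -mult_INR; apply: le_INR; apply/leP.
  have pa := pos a.
  have n1 : (INR n <= INR k.+1 / INR a.+1)%R.
    have -> : INR n = (INR n * INR a.+1 / INR a.+1)%R by field; lra.
    apply: Rmult_le_compat_r => //; apply/Rlt_le/Rinv_0_lt_compat => //.
  have := Rmult_le_compat_l _ _ _ (pos_INR (u a.+1)) n1.
  have -> : (INR (u a.+1) / INR a.+1 * INR k.+1 = INR (u a.+1) * (INR k.+1 / INR a.+1))%R.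
    by field; lra.
  lra.
have u0 := pos_INR (u a.+1).
have h1 : (INR (u a.+1) / INR a.+1 * INR k.+1 < (- d + eps / 2) * INR k.+1)%R.
  exact: Rmult_lt_compat_r.
set w := ((INR (u k.+1) - 1) / INR k.+1)%R.
have wE : (w * INR k.+1 = INR (u k.+1) - 1)%R by rewrite /w; field; lra.
apply: Rabs_def1; apply: (Rmult_lt_reg_r (INR k.+1)) => //; lra.
Qed.

End RationalGrowth.

(** * Specialization to the canonical projection onto [{ideal_quot I}] *)

Section QuotientByIdeal.
Local Open Scope ring_scope.
Local Open Scope quotient_scope.
Variables (A : comNzRingType) (m : A -> Prop) (I : idealr A).
Hypotheses (noeA : noetherian A) (locA : local_ring_with m).

Let I' : A -> Prop := fun x => x \in I.

Let surj_pi (y : {ideal_quot I}) : exists x, \pi_({ideal_quot I}) x = y.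
Proof. by exists (repr y); rewrite reprK. Qed.

Let ker_pi x : I' x <-> \pi_({ideal_quot I}) x = 0.
Proof.
rewrite /I' -{1}[x]subr0 Quotient.idealrBE -[0 in RHS](rmorph0 \pi_({ideal_quot I})).
by split=> /eqP.
Qed.

Lemma r_quot_attained : exists Q, minred m I' Q /\ redeq m I' Q (r_quot m I).
Proof. exact: (r_num_attained locA surj_pi ker_pi noeA). Qed.

Lemma r_quot_le Q s : minred m I' Q -> redeq m I' Q s -> (r_quot m I <= s)%N.
Proof. exact: (r_num_le locA surj_pi ker_pi). Qed.

Lemma idealr_is_ideal : is_ideal I'.
Proof.
split; [exact: rpred0 | by move=> x y; apply: rpredD | by move=> a x; apply: idealMr].
Qed.

Lemma idealr_sub_local : subI I' m.
Proof.
apply: (proper_sub_local locA); first exact: idealr_is_ideal.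
by rewrite /I' idealr1.
Qed.

End QuotientByIdeal.

Theorem theorem1p5 (Rg : comNzRingType) (m : Rg -> Prop) (I : nat -> idealr Rg) :
  noetherian Rg -> local_ring_with m -> infinite_residue_field m ->
  (forall k, (1 <= k)%N -> subI (fun x => x \in I k.+1) (fun x => x \in I k)) ->
  (forall a b, (1 <= a)%N -> (1 <= b)%N ->
     subI (prodI (fun x => x \in I a) (fun x => x \in I b))
          (fun x => x \in I (a + b)%N)) ->
  (forall k, (1 <= k)%N -> dim_quot (I k) = dim_quot (I 1%N)) ->
  (forall k, (1 <= k)%N ->
     (r_quot m (I k) <= (r_quot m (I 1%N)).+1 * k - 1)%N) /\
  (exists c : Rdefinitions.R,
     Rseries.Un_cv
       (fun k => Rdefinitions.Rdiv (Raxioms.INR (r_quot m (I k.+1))) (Raxioms.INR k.+1)) c /\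
     forall k, (1 <= k)%N ->
       Rdefinitions.Rle
         (Rdefinitions.Rminus (Rdefinitions.Rmult c (Raxioms.INR k)) Rdefinitions.R1)
         (Raxioms.INR (r_quot m (I k)))).
Proof.
move=> noeR locR _ decI mulI _.
pose J k x : Prop := x \in I k.
have iJ k : is_ideal (J k) by apply: idealr_is_ideal.
have Jm k : (1 <= k)%N -> subI (J k) m by move=> _; apply: idealr_sub_local.
(* The shift by one turns the exponent bound of [minred_up] into [u (a k) <= k u a]. *)
pose u k := (r_quot m (I k)).+1.
have u_mul a k : (1 <= a)%N -> (u (a * k.+1) <= u a * k.+1)%N.
  move=> a0; have [Q [minQ redQ]] := r_quot_attained (I a) noeR locR.
  have [K [minK redK]] := minred_up noeR locR iJ decI mulI k a0 minQ redQ.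
  by have := r_quot_le locR minK redK; rewrite /u; lia.
have u_homo a b : (1 <= a)%N -> (a <= b)%N -> (u a <= u b)%N.
  move=> a0 ab; have [Q [minQ redQ]] := r_quot_attained (I b) noeR locR.
  have minK := minred_down locR iJ Jm decI mulI a0 ab minQ.
  rewrite ltnS; apply: (r_quot_le locR minK); apply: redeqS redQ.
    exact: (filtrationS decI).
  exact: addI_subl.
(* Part (i) is [u_mul] at [a = 1]. *)
split=> [[//|k] _|].
  by have := u_mul 1%N k isT; rewrite mul1n /u; lia.
(* As [u k - 1] is the reduction number, this is the required limit, and [c k <= u k] is the lower
   bound in (ii). *)
have [c [uc cu]] := growth_limit u_homo u_mul.
exists c; split=> [eps /uc[N uN]|k /cu]; last first.
  by rewrite /u RIneq.S_INR => h; Lra.lra.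
exists N => k /uN; rewrite /u RIneq.S_INR.
congr (Rdefinitions.Rlt (Rfunctions.Rdist (Rdefinitions.Rdiv _ _) _) _).
by Lra.lra.
Qed.
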